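(* Suppose $U$ is a unitary operator on a composite Hilbert space $\mathcal{H}$ of dimension $d$. Then the following five statements are equivalent: (1) $\mu(U)=d$; (2) $\mathrm{Prod}(U)$ is a connected spanning set; (3) $\mathrm{Prod}(U)$ contains a connected basis as a subset; (4) $U$ admits an entanglement-free minimal identification set (EFMIS); (5) $U$ can be verified by an entanglement-free protocol.
   Context: A verification protocol for a unitary $U$ on $\mathcal{H}$ consists of a set of input test states (pure product states), each chosen with positive probability, together with a verification protocol for each corresponding output state $U|\psi_j\rangle$ based on nonadaptive local projective measurements, with verification operator $\Omega_j$; $U$ is verified reliably if only the unitary channel of $U$ passes every test with certainty. The protocol is ordinary if every $\Omega_j$ has positive spectral gap (one minus its second largest eigenvalue). One experimental setting means the preparation of a pure product input state together with one nonadaptive local projective measurement on the output state. $\mu(U)$ denotes the minimum number of experimental settings required to verify $U$ by ordinary protocols. $\mathrm{Prod}$ is the set of pure product states and $\mathrm{Prod}(U)=\{|\psi\rangle\in\mathrm{Prod} : U|\psi\rangle\in\mathrm{Prod}\}$. The transition graph of a set of pure states has the states as vertices, two vertices adjacent iff the states are non-orthogonal; the set is connected if its transition graph is connected. A connected spanning set is a connected set spanning $\mathcal{H}$; a connected basis is a connected set that is a basis of $\mathcal{H}$. An identification set (IS) is a set $\{|\psi_j\rangle\}$ of pure states such that any quantum channel $\Lambda$ with $\Lambda(|\psi_j\rangle\langle\psi_j|)=U|\psi_j\rangle\langle\psi_j|U^\dagger$ for all $j$ must equal the unitary channel of $U$; a minimal identification set (MIS) is an IS no proper subset of which is an IS (equivalently,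 a connected basis). An EFMIS for $U$ is an MIS contained in $\mathrm{Prod}(U)$. A verification protocol is entanglement free if all input test states and the corresponding output states are product states and all measurements are local projective measurements. *)

(* Defs.v *)
From HB Require Import structures.
From mathcomp Require Import all_boot all_order all_algebra reals complex.
From Stdlib Require List.
Set Implicit Arguments. Unset Strict Implicit. Unset Printing Implicit Defensive.
Import Order.TTheory GRing.Theory Num.Theory.
Local Open Scope ring_scope.

Section Quantum.

(* n parties, party i has local space C^(dims i).  A global computational-basis *)
(* index is a multi-index  idx = (k_i)_i ; H = C^dimH with dimH = #|idx|.       *)
Variable n : nat.
Variable dims : 'I_n -> nat.

Definition idx := {dffun forall i : 'I_n, 'I_(dims i)}.
Definition dimH : nat := #|{: idx}|.
Definition midx (r : 'I_dimH) : idx := enum_val r.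

Variable R : realType.
Local Notation C := R[i].
Local Notation vec := 'cV[C]_dimH.
Local Notation op := 'M[C]_dimH.

Definition adj {p q} (M : 'M[C]_(p, q)) : 'M[C]_(q, p) := (map_mx Num.conj M)^T.
Definition dot (u v : vec) : C := (adj u *m v) 0 0.
Definition proj (v : vec) : op := v *m adj v.

Definition pure_state (v : vec) : Prop := dot v v = 1.

Definition tens (A : forall i : 'I_n, 'M[C]_(dims i)) : op :=
  \matrix_(r, c) \prod_(i : 'I_n) A i (midx r i) (midx c i).

Definition Prod (v : vec) : Prop :=
  pure_state v /\
  exists phi : forall i : 'I_n, 'cV[C]_(dims i),
    forall r : 'I_dimH, v r 0 = \prod_(i : 'I_n) phi i (midx r i) 0.

Definition ProdU (U : op) (v : vec) : Prop := Prod v /\ Prod (U *m v).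

Definition nonorth (u v : vec) : bool := dot u v != 0.

Definition connected_set (S : vec -> Prop) : Prop :=
  forall u v, S u -> S v ->
    exists p : seq vec, (forall x, x \in p -> S x) /\ path nonorth u p /\ last u p = v.

Definition spanning_set (S : vec -> Prop) : Prop :=
  forall v : vec, exists s : seq vec, (forall x, x \in s -> S x) /\ v \in <<s>>%VS.

Definition lin_indep_set (S : vec -> Prop) : Prop :=
  forall s : seq vec, uniq s -> (forall x, x \in s -> S x) -> free s.

Definition basis_set (S : vec -> Prop) : Prop := spanning_set S /\ lin_indep_set S.

Definition connected_spanning_set (S : vec -> Prop) : Prop :=
  connected_set S /\ spanning_set S.

Definition connected_basis (S : vec -> Prop) : Prop :=
  connected_set S /\ basis_set S.

Definition subset_of (S T : vec -> Prop) : Prop := forall v, S v -> T v.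
Definition proper_subset_of (S T : vec -> Prop) : Prop :=
  subset_of S T /\ exists v, T v /\ ~ S v.

Definition linear_map (L : op -> op) : Prop :=
  forall (a : C) (X Y : op), L (a *: X + Y) = a *: L X + L Y.

(* positive semidefiniteness of a k x k block operator on C^k (x) H *)
Definition psd_block k (X : 'I_k -> 'I_k -> op) : Prop :=
  forall w : 'I_k -> vec, 0 <= \sum_(a < k) \sum_(b < k) dot (w a) (X a b *m w b).

Definition completely_positive (L : op -> op) : Prop :=
  forall k (X : 'I_k -> 'I_k -> op), psd_block X -> psd_block (fun a b => L (X a b)).

Definition trace_preserving (L : op -> op) : Prop := forall X, \tr (L X) = \tr X.

Definition quantum_channel (L : op -> op) : Prop :=
  [/\ linear_map L, completely_positive L & trace_preserving L].

Definition unitary_channel (U : op) : op -> op := fun X => U *m X *m adj U.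

Definition identification_set (U : op) (S : vec -> Prop) : Prop :=
  forall L, quantum_channel L ->
    (forall v, S v -> L (proj v) = unitary_channel U (proj v)) ->
    forall X, L X = unitary_channel U X.

Definition minimal_identification_set (U : op) (S : vec -> Prop) : Prop :=
  (forall v, S v -> pure_state v) /\ identification_set U S /\
  forall S', proper_subset_of S' S -> ~ identification_set U S'.

Definition EFMIS (U : op) (S : vec -> Prop) : Prop :=
  minimal_identification_set U S /\ subset_of S (ProdU U).

(* A nonadaptive local projective measurement: party i performs the projective  *)
(* measurement {M i a}_a (outcomes labelled by 'I_(dims i); zero projectors     *)
(* allowed, so every projective measurement on C^(dims i) is covered).  Joint   *)
(* outcomes are then multi-indices o : idx.                                     *)
Definition local_meas := forall i : 'I_n, 'I_(dims i) -> 'M[C]_(dims i).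

Definition is_local_projective (M : local_meas) : Prop :=
  forall i : 'I_n,
    (forall a, M i a *m M i a = M i a /\ adj (M i a) = M i a) /\
    \sum_(a : 'I_(dims i)) M i a = 1%:M.

Definition pass_proj (M : local_meas) (acc : {set idx}) : op :=
  \sum_(o in acc) tens (fun i => M i (o i)).

(* one experimental setting on an output state: a local projective measurement  *)
(* together with the tests (probability, accepted outcomes) based on it         *)
Definition setting := (local_meas * seq (C * {set idx}))%type.

Definition state_protocol := seq setting.

Definition state_protocol_valid (phi : vec) (sp : state_protocol) : Prop :=
  (forall s, List.In s sp -> is_local_projective s.1) /\
  (forall s, List.In s sp -> forall t, List.In t s.2 -> 0 < t.1) /\
  \sum_(s <- sp) \sum_(t <- s.2) t.1 = 1 /\
  (forall s, List.In s sp -> forall t, List.In t s.2 -> \tr (pass_proj s.1 t.2 *m proj phi) = 1).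

Definition verif_op (sp : state_protocol) : op :=
  \sum_(s <- sp) \sum_(t <- s.2) t.1 *: pass_proj s.1 t.2.

Definition sorted_eigenvalues (A : op) : seq C :=
  sort (fun x y : C => y <= x) [seq spectral_diag A 0 j | j <- enum 'I_dimH].

Definition second_largest_eigenvalue (A : op) : C := nth 0 (sorted_eigenvalues A) 1.

Definition spectral_gap (A : op) : C := 1 - second_largest_eigenvalue A.

(* a verification protocol for U: test input states psi_j (pure product states) *)
(* chosen with probabilities p_j, each with a protocol for U psi_j              *)
Definition protocol := seq (vec * C * state_protocol).

Definition protocol_valid (U : op) (P : protocol) : Prop :=
  (forall t, List.In t P -> [/\ Prod t.1.1, 0 < t.1.2 & state_protocol_valid (U *m t.1.1) t.2]) /\
  \sum_(t <- P) t.1.2 = 1.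

Definition passes_all (L : op -> op) (P : protocol) : Prop :=
  forall t, List.In t P -> forall s, List.In s t.2 -> forall u, List.In u s.2 ->
    \tr (pass_proj s.1 u.2 *m L (proj t.1.1)) = 1.

Definition verifies_reliably (U : op) (P : protocol) : Prop :=
  protocol_valid U P /\
  forall L, quantum_channel L -> passes_all L P -> forall X, L X = unitary_channel U X.

Definition ordinary (P : protocol) : Prop :=
  forall t, List.In t P -> 0 < spectral_gap (verif_op t.2).

Definition entanglement_free (U : op) (P : protocol) : Prop :=
  forall t, List.In t P -> Prod t.1.1 /\ Prod (U *m t.1.1).

Definition num_settings (P : protocol) : nat := \sum_(t <- P) size t.2.

Definition mu_eq (U : op) (m : nat) : Prop :=
  (exists P, verifies_reliably U P /\ ordinary P /\ num_settings P = m) /\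
  (forall P, verifies_reliably U P -> ordinary P -> (m <= num_settings P)%N).

End Quantum.

(* Main.v *)
Require Import Defs.
From HB Require Import structures.
From mathcomp Require Import all_boot all_order all_algebra reals complex.
From mathcomp Require Import boolp ring.
Import Order.TTheory GRing.Theory Num.Theory.
Local Open Scope ring_scope.

(* A set of pure states is an identification set iff it is connected and spans.
   If it is not, some orthogonal projector P is nontrivial and maps every state
   of the set to itself or to 0; the reflection W = 2P - 1 fixes the states up to
   sign, so U and UW act alike on them.  Conversely, let U = 1 and let L be a
   channel fixing |u><u| for all u in S.  Complete positivity makes the kernel
   (x, u), (y, v) |-> <x, L(|u><v|) y> positive semidefinite, and it vanishes at
   (x, u) for x orthogonal to u; hence L(|u><v|) = c(u, v) |u><v|, where c is a
   correlation matrix.  Trace preservation gives c(u, v) = 1 for nonorthogonal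
   u, v, positivity propagates this along paths, and linearity gives L = id.

   The inputs of a reliable protocol form an identification set, so there are at
   least d of them.  With exactly d settings each output is tested by a single
   local measurement, and a positive gap then forces the output to be a product
   state.  Conversely a connected basis inside Prod(U) is tested with one
   two-outcome measurement per party and per state. *)

Set Implicit Arguments.
Unset Strict Implicit.
Unset Printing Implicit Defensive.

(** * Adjoints of complex matrices *)

Section Adjoint.

Variable R : realType.
Local Notation C := R[i].

Lemma adjmxE p q (M : 'M[C]_(p, q)) i j : adj M i j = (M j i)^*.
Proof. by rewrite !mxE. Qed.

Lemma adjmxK p q (M : 'M[C]_(p, q)) : adj (adj M) = M.
Proof. by apply/matrixP => i j; rewrite !adjmxE conjCK. Qed.

Lemma adjmx_delta p q i j :
  adj (delta_mx i j : 'M[C]_(p, q)) = delta_mx j i.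
Proof. by apply/matrixP => k l; rewrite !mxE rmorph_nat andbC. Qed.

Lemma adjmxD p q (M N : 'M[C]_(p, q)) : adj (M + N) = adj M + adj N.
Proof. by apply/matrixP => i j; rewrite !mxE rmorphD. Qed.

Lemma adjmxB p q (M N : 'M[C]_(p, q)) : adj (M - N) = adj M - adj N.
Proof. by apply/matrixP => i j; rewrite !mxE rmorphB. Qed.

Lemma adjmx0 p q : adj (0 : 'M[C]_(p, q)) = 0.
Proof. by apply/matrixP => i j; rewrite !mxE rmorph0. Qed.

Lemma adjmxZ p q a (M : 'M[C]_(p, q)) : adj (a *: M) = a^* *: adj M.
Proof. by apply/matrixP => i j; rewrite !mxE rmorphM. Qed.

Lemma adjmx1 p : adj (1%:M : 'M[C]_p) = 1%:M.
Proof. by rewrite /adj map_mx1 trmx1. Qed.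

Lemma adjmxM p q r (M : 'M[C]_(p, q)) (N : 'M[C]_(q, r)) :
  adj (M *m N) = adj N *m adj M.
Proof. by rewrite /adj map_mxM trmx_mul. Qed.

Lemma adjmx_sum p q I (r : seq I) (P : pred I) (F : I -> 'M[C]_(p, q)) :
  adj (\sum_(i <- r | P i) F i) = \sum_(i <- r | P i) adj (F i).
Proof. exact: (big_morph _ (@adjmxD p q) (adjmx0 p q)). Qed.

Lemma mxtrace_adj_ge0 p q (M : 'M[C]_(p, q)) : 0 <= \tr (adj M *m M).
Proof.
apply: sumr_ge0 => i _; rewrite mxE; apply: sumr_ge0 => j _.
by rewrite adjmxE mulrC mul_conjC_ge0.
Qed.

Lemma mxtrace_adj_eq0 p q (M : 'M[C]_(p, q)) : \tr (adj M *m M) = 0 -> M = 0.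
Proof.
move=> /eqP; rewrite psumr_eq0 => [|i _]; last first.
  by rewrite mxE sumr_ge0// => j _; rewrite adjmxE mulrC mul_conjC_ge0.
move=> /allP tr0; apply/matrixP => i j; rewrite mxE.
have /implyP/(_ isT) := tr0 j (mem_index_enum j).
rewrite mxE psumr_eq0 => [|k _]; last by rewrite adjmxE mulrC mul_conjC_ge0.
move=> /allP /(_ i (mem_index_enum i)) /implyP/(_ isT).
by rewrite adjmxE mulrC mul_conjC_eq0 => /eqP.
Qed.

Lemma unitary_adjr p (U : 'M[C]_p) : U \is unitarymx -> U *m adj U = 1%:M.
Proof. by move=> /unitarymxP; rewrite /adj map_trmx. Qed.

Lemma unitary_adjl p (U : 'M[C]_p) : U \is unitarymx -> adj U *m U = 1%:M.
Proof. by move=> /unitary_adjr /mulmx1C. Qed.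

End Adjoint.

(** * Inner products and orthogonal projectors *)

Section Dot.

Variables (n : nat) (dims : 'I_n -> nat) (R : realType).
Local Notation C := R[i].
Local Notation vec := 'cV[C]_(dimH dims).
Local Notation op := 'M[C]_(dimH dims).
Implicit Types (u v w x y : vec) (M : op).

Lemma adj_mul_dot u v : adj u *m v = (dot u v)%:M.
Proof. exact: mx11_scalar. Qed.

Lemma dotDl u v w : dot (u + v) w = dot u w + dot v w.
Proof. by rewrite /dot adjmxD mulmxDl mxE. Qed.

Lemma dotDr u v w : dot u (v + w) = dot u v + dot u w.
Proof. by rewrite /dot mulmxDr mxE. Qed.

Lemma dotBl u v w : dot (u - v) w = dot u w - dot v w.
Proof. by rewrite /dot adjmxB mulmxBl !mxE. Qed.

Lemma dotBr u v w : dot u (v - w) = dot u v - dot u w.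
Proof. by rewrite /dot mulmxBr !mxE. Qed.

Lemma dotZl a u v : dot (a *: u) v = a^* * dot u v.
Proof. by rewrite /dot adjmxZ -scalemxAl mxE. Qed.

Lemma dotZr a u v : dot u (a *: v) = a * dot u v.
Proof. by rewrite /dot -scalemxAr mxE. Qed.

Lemma dot0l v : dot 0 v = 0.
Proof. by rewrite /dot adjmx0 mul0mx mxE. Qed.

Lemma dot0r v : dot v 0 = 0.
Proof. by rewrite /dot mulmx0 mxE. Qed.

Lemma dot_suml I (r : seq I) (P : pred I) (F : I -> vec) v :
  dot (\sum_(i <- r | P i) F i) v = \sum_(i <- r | P i) dot (F i) v.
Proof.
by apply: (big_morph (fun u => dot u v)) => [u w|]; rewrite ?dotDl ?dot0l.
Qed.

Lemma dotC u v : dot u v = (dot v u)^*.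
Proof. by rewrite -[RHS]adjmxE adjmxM adjmxK. Qed.

Lemma dot_mulr u M v : dot u (M *m v) = dot (adj M *m u) v.
Proof. by rewrite /dot adjmxM adjmxK mulmxA. Qed.

Lemma dot_eq0C u v : dot u v = 0 -> dot v u = 0.
Proof. by move=> uv0; rewrite dotC uv0 rmorph0. Qed.

Lemma dot_mxtrace u v M : dot u (M *m v) = \tr (M *m (v *m adj u)).
Proof. by rewrite mulmxA mxtrace_mulC trace_mx11. Qed.

Lemma mxtrace_outer u v : \tr (u *m adj v) = dot v u.
Proof. by rewrite mxtrace_mulC trace_mx11. Qed.

Lemma mulmx_outer u v w : u *m adj v *m w = dot v w *: u.
Proof. by rewrite -mulmxA adj_mul_dot mul_mx_scalar. Qed.

Lemma mulmx_outerM u v M : u *m adj v *m M = u *m adj (adj M *m v).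
Proof. by rewrite adjmxM adjmxK mulmxA. Qed.

Lemma dot_ge0 v : 0 <= dot v v.
Proof. by rewrite -mxtrace_outer mxtrace_mulC mxtrace_adj_ge0. Qed.

Lemma dot_eq0 v : dot v v = 0 -> v = 0.
Proof. by rewrite -mxtrace_outer mxtrace_mulC; apply: mxtrace_adj_eq0. Qed.

Lemma adjmx_proj v : adj (proj v) = proj v.
Proof. by rewrite adjmxM adjmxK. Qed.

Lemma mulmx_proj v w : proj v *m w = dot v w *: v.
Proof. exact: mulmx_outer. Qed.

Lemma nonorth_sym u v : nonorth u v = nonorth v u.
Proof. by rewrite /nonorth dotC conjC_eq0. Qed.

Lemma pure_state_neq0 v : pure_state v -> v != 0.
Proof.
move=> v1; apply/eqP => v0; move: v1; rewrite /pure_state v0 dot0l.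
by move=> /esym/eqP; rewrite oner_eq0.
Qed.

Lemma proj_unitary (U : op) v : proj (U *m v) = unitary_channel U (proj v).
Proof. by rewrite /unitary_channel /proj adjmxM !mulmxA. Qed.

(** The squared norm of [M v - v] expands to 1 - 1 - 1 + 1. *)
Lemma hermitian_idem_fix M v :
  adj M = M -> M *m M = M -> pure_state v -> dot v (M *m v) = 1 -> M *m v = v.
Proof.
move=> Mh Mi v1 vMv; apply/eqP; rewrite -subr_eq0; apply/eqP/dot_eq0.
rewrite dotBl !dotBr v1 vMv (dotC _ v) vMv rmorph1 dot_mulr Mh mulmxA Mi dotC.
by rewrite vMv rmorph1 !subrr.
Qed.

Lemma col_op_ext M N : (forall v, M *m v = N *m v) -> M = N.
Proof.
move=> MN; apply/trmx_inj/row_matrixP => j; rewrite -!tr_col !colE.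
by rewrite MN.
Qed.

(** Gram-Schmidt along the list: the projector [P] of the tail gains the rank-one projector onto
    [z], the component of the new vector orthogonal to the old span. *)
Lemma exists_orth_proj (s : seq vec) : exists P : op,
  [/\ adj P = P, P *m P = P, forall x, x \in <<s>>%VS -> P *m x = x &
      (forall y, P *m y \in <<s>>%VS) /\
      forall y, (forall x, x \in s -> dot x y = 0) -> P *m y = 0].
Proof.
elim: s => [|x s [P [Ph Pi Ps [Pr P0]]]].
  exists 0; split; rewrite ?adjmx0 ?mul0mx//.
    by move=> x; rewrite span_nil memv0 => /eqP ->; rewrite mulmx0.
  by split=> y; rewrite ?mul0mx// mem0v.
have sub y : y \in <<s>>%VS -> y \in <<x :: s>>%VS.
  by rewrite span_cons; apply: (subvP (addvSr _ _)).
pose z := x - P *m x.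
have Pz : P *m z = 0 by rewrite mulmxBr mulmxA Pi subrr.
have zin : z \in <<x :: s>>%VS.
  by apply: rpredB; [rewrite memv_span ?mem_head | exact: sub].
have fixP (Q : op) : (forall y, y \in s -> Q *m y = y) -> Q *m x = x ->
    forall y, y \in <<x :: s>>%VS -> Q *m y = y.
  move=> Qs Qx y /(@coord_span _ _ _ (in_tuple (x :: s))) ->.
  rewrite mulmx_sumr; apply: eq_bigr => i _.
  rewrite -scalemxAr; congr (_ *: _).
  by move: i => [[|i]] /= ip; rewrite ?Qx// Qs// mem_nth.
have [z0|z0] := eqVneq z 0.
  exists P; split => //.
    apply: fixP => [y ys|]; first by rewrite Ps ?memv_span.
    by apply/esym/eqP; rewrite -subr_eq0 -/z z0.
  split=> y; first exact/sub/Pr.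
  by move=> sy; apply: P0 => w ws; rewrite sy// in_cons ws orbT.
have zz0 : dot z z != 0 by apply: contra_neq z0; apply: dot_eq0.
have xz : dot z x = dot z z.
  by rewrite /z dotBr dot_mulr Ph Pz dot0l subr0.
exists (P + (dot z z)^-1 *: proj z); split.
- by rewrite adjmxD adjmxZ Ph adjmx_proj conj_Creal // rpredV ger0_real ?dot_ge0.
- have Pp : P *m proj z = 0 by rewrite mulmxA Pz mul0mx.
  have pP : proj z *m P = 0 by rewrite mulmx_outerM Ph Pz adjmx0 mulmx0.
  have pp : proj z *m proj z = dot z z *: proj z.
    by rewrite {2}/proj mulmxA mulmx_proj -scalemxAl.
  rewrite mulmxDl !mulmxDr Pi -!scalemxAr -!scalemxAl Pp pP pp !scaler0 addr0.
  by rewrite add0r !scalerA -mulrA mulVf// mulr1.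
- apply: fixP => [y ys|]; rewrite mulmxDl -scalemxAl mulmx_proj.
    rewrite Ps ?memv_span//; suff -> : dot z y = 0 by rewrite scale0r scaler0 addr0.
    by rewrite -[y]Ps ?memv_span// dot_mulr Ph Pz dot0l.
  by rewrite xz scalerA mulVf// scale1r addrC subrK.
split=> y.
  rewrite mulmxDl; apply: rpredD; first exact/sub/Pr.
  by rewrite -scalemxAl mulmx_proj !rpredZ.
move=> sy; have Py : P *m y = 0.
  by apply: P0 => w ws; rewrite sy// in_cons ws orbT.
have zy : dot z y = 0.
  by rewrite dotBl sy ?mem_head// -Ph -dot_mulr Py dot0r subr0.
by rewrite mulmxDl Py add0r -scalemxAl mulmx_proj zy scale0r scaler0.
Qed.

End Dot.

(** * A limiting argument for nonnegative quadratic expressions *)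

Section Psd.

Variable C : numClosedFieldType.

Lemma ge0_linear_quadratic (z r : C) :
  0 <= r -> (forall s, 0 < s -> 0 <= s * z + s ^+ 2 * r) ->
  (forall s, 0 < s -> 0 <= - (s * z) + s ^+ 2 * r) -> z = 0.
Proof.
move=> r0 zp zm; apply/eqP; apply/negPn/negP => z0.
have rr : r \is Num.real by apply: ger0_real.
(* At s = 1 the hypothesis makes [z + r] real; only then does [z] have a sign. *)
have zr : z \is Num.real.
  have := zp _ ltr01; rewrite mul1r expr1n mul1r => /ger0_real h.
  by rewrite -[z](addrK r) rpredB.
(* Small enough that the quadratic term stays below the linear one, that is [s * r < |z|]; adding 1
   to [r] keeps the denominator positive. *)
pose s := `|z| / (2 * (r + 1)).
have r1 : 0 < 2 * (r + 1) by rewrite mulr_gt0// ltr_wpDl.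
have s0 : 0 < s by rewrite divr_gt0 ?normr_gt0.
have sr : s * r < `|z|.
  rewrite /s mulrAC ltr_pdivrMr// ltr_pM2l ?normr_gt0//.
  rewrite mulrDr mulr1 mulr_natl mulr2n -addrA ltrDl.
  by rewrite ltr_wpDl.
have [zge|zlt] := real_ge0P zr.
- have := zm s s0; rewrite expr2 -mulrA -mulrN -mulrDr pmulr_rge0// addrC subr_ge0.
  by move=> h; have := le_lt_trans h sr; rewrite ger0_norm// ltxx.
- have := zp s s0; rewrite expr2 -mulrA -mulrDr pmulr_rge0//.
  rewrite -lerBlDl sub0r.
  by move=> h; have := le_lt_trans h sr; rewrite ltr0_norm// ltxx.
Qed.

End Psd.

(** * Channels that fix a connected spanning set of states *)

Section Channel.

Variables (n : nat) (dims : 'I_n -> nat) (R : realType).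
Local Notation C := R[i].
Local Notation vec := 'cV[C]_(dimH dims).
Local Notation op := 'M[C]_(dimH dims).
Implicit Types (u v w x y : vec).

(** Hermitian symmetry is implied, since a complex form with only real values is Hermitian. *)
Definition psd k (M : 'M[C]_k) := forall a : 'cV[C]_k, 0 <= (adj a *m M *m a) 0 0.

(** With [a] isotropic, the form at [a + t b] has no constant term, so its linear part in [t] must
    vanish. Real [t] isolate the sum of the two cross terms and imaginary [t] their difference;
    hence both are zero. *)
Lemma psd_radical k (M : 'M[C]_k) (a : 'cV[C]_k) :
  psd M -> (adj a *m M *m a) 0 0 = 0 -> M *m a = 0 /\ adj a *m M = 0.
Proof.
move=> Mp qa.
have cross (b : 'cV[C]_k) :
    (adj b *m M *m a) 0 0 = 0 /\ (adj a *m M *m b) 0 0 = 0.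
  set p := (_ *m a) 0 0; set q := (_ *m b) 0 0; set r := (adj b *m M *m b) 0 0.
  have quad (t : C) : 0 <= t^* * p + t * q + t^* * t * r.
    have add00 (X Y : 'M[C]_1) : (X + Y) 0 0 = X 0 0 + Y 0 0 by rewrite mxE.
    have scale00 e (X : 'M[C]_1) : (e *: X) 0 0 = e * X 0 0 by rewrite mxE.
    have := Mp (a + t *: b).
    rewrite adjmxD adjmxZ !mulmxDl -!scalemxAl !mulmxDr -!scalemxAr !scalerDr.
    rewrite !add00 !scale00 qa -/p -/q -/r => h; apply: le_trans h _.
    by rewrite le_eqVlt; apply/orP; left; apply/eqP; ring.
  have r0 : 0 <= r := Mp b.
  have sr (s : C) : 0 < s -> s^* = s by move=> /gtr0_real /CrealP.
  have e1 : p + q = 0.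
    apply: (ge0_linear_quadratic r0) => s /sr es.
      by have := quad s; rewrite es mulrDr expr2.
    by have := quad (- s); rewrite rmorphN /= es mulrNN !mulNr mulrDr opprD expr2.
  have e2 : 'i * (q - p) = 0.
    apply: (ge0_linear_quadratic r0) => s /sr es.
      have := quad ('i * s); rewrite rmorphM /= conjCi es => h.
      apply: le_trans h _; rewrite le_eqVlt; apply/orP; left; apply/eqP.
      rewrite (_ : - 'i * s * ('i * s) = - 'i ^+ 2 * s ^+ 2); last by ring.
      by rewrite sqrCi; ring.
    have := quad (- 'i * s); rewrite rmorphM rmorphN /= conjCi opprK es => h.
    apply: le_trans h _; rewrite le_eqVlt; apply/orP; left; apply/eqP.
    rewrite (_ : 'i * s * (- 'i * s) = - 'i ^+ 2 * s ^+ 2); last by ring.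
    by rewrite sqrCi; ring.
  have e3 : q = p.
    move/eqP: e2; rewrite mulf_eq0 (negPf (neq0Ci _)) subr_eq0 => /eqP.
    exact.
  by move: e1; rewrite e3 => /eqP; rewrite -mulr2n mulrn_eq0 /= => /eqP.
have deltaE (i : 'I_k) : adj (delta_mx i 0 : 'cV[C]_k) = delta_mx 0 i.
  exact: adjmx_delta.
split; apply/matrixP => i j; rewrite ord1 [RHS]mxE.
  by have [<- _] := cross (delta_mx i 0); rewrite -mulmxA deltaE -rowE !mxE.
by have [_ <-] := cross (delta_mx j 0); rewrite -colE !mxE.
Qed.

Section CompletelyPositive.

Variable L : op -> op.
Hypothesis Lcp : completely_positive L.

(** Samples the kernel <x, L(|u><v|) y> at the finitely many pairs [(w a, u a)]. *)
Definition cp_form k (w u : 'I_k -> vec) : 'M[C]_k :=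
  \matrix_(a, b) dot (w a) (L (u a *m adj (u b)) *m w b).

(** The block operator with blocks |u a><u b| is positive, its form being the squared modulus of a
    single sum [z]. Complete positivity carries this over to [L], and the test vectors [c a *: w a]
    give the form at [c]. *)
Lemma psd_cp_form k (w u : 'I_k -> vec) : psd (cp_form w u).
Proof.
move=> c.
have Xp : psd_block (fun a b => u a *m adj (u b)).
  move=> v; pose z := \sum_(b < k) dot (u b) (v b).
  rewrite (_ : \sum_(a < k) _ = z^* * z); first by rewrite mulrC mul_conjC_ge0.
  rewrite rmorph_sum mulr_suml; apply: eq_bigr => a _ /=.
  rewrite mulr_sumr; apply: eq_bigr => b _.
  by rewrite mulmx_outer dotZr mulrC [dot (v a) _]dotC.
have := Lcp Xp (fun a => c a 0 *: w a).
rewrite (_ : \sum_(a < k) _ = (adj c *m cp_form w u *m c) 0 0)//.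
rewrite mxE exchange_big /=; apply: eq_bigr => b _; rewrite mxE mulr_suml.
apply: eq_bigr => a _.
by rewrite adjmxE mxE dotZl -scalemxAr dotZr; ring.
Qed.

Lemma channel_proj_ge0 u x : 0 <= dot x (L (proj u) *m x).
Proof.
have := psd_cp_form (fun=> x) (fun=> u) (delta_mx 0 0 : 'cV_1).
rewrite -mulmxA -colE mxE big_ord1 adjmxE !mxE /= rmorph_nat /=.
by rewrite mul1r.
Qed.

(** The 2 x 2 kernel matrix at (x, u) and (y, v) is positive with a zero diagonal entry, so the row
    and the column of that entry vanish. *)
Lemma cp_isotropic u x v y : dot x (L (proj u) *m x) = 0 ->
  dot x (L (u *m adj v) *m y) = 0 /\ dot y (L (v *m adj u) *m x) = 0.
Proof.
move=> ux; pose w (a : 'I_2) := nth 0 [:: x; y] a.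
pose z (a : 'I_2) := nth 0 [:: u; v] a.
have e0 : adj (delta_mx 0 0 : 'cV[C]_2) = delta_mx 0 0.
  exact: adjmx_delta.
have [|Me eM] := psd_radical (a := delta_mx 0 0) (psd_cp_form w z).
  by rewrite e0 -mulmxA -rowE -colE !mxE.
split.
- by move/matrixP: eM => /(_ 0 1); rewrite e0 -rowE !mxE.
- by move/matrixP: Me => /(_ 1 0); rewrite -colE !mxE.
Qed.

Hypothesis Llin : linear_map L.
Hypothesis Ltp : trace_preserving L.

(** The entry c(u, v) of the correlation matrix: for unit vectors it is the coefficient of |u><v|
    once L(|u><v|) is known to be a multiple of it. *)
Definition coherence u v := dot u (L (u *m adj v) *m v).

Section Fixed.

Variable S : vec -> Prop.
Hypothesis Spure : forall v, S v -> pure_state v.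
Hypothesis Sfix : forall v, S v -> L (proj v) = proj v.

Lemma fixed_isotropic u x : S u -> dot u x = 0 -> dot x (L (proj u) *m x) = 0.
Proof. by move=> Su ux; rewrite Sfix// mulmx_proj ux scale0r dot0r. Qed.

(** The two sides are treated separately. Vectors orthogonal to [u] are isotropic for [L (proj u)],
    which forces the range of [A] into the line of [u]; by the same argument for [v], [A] kills
    everything orthogonal to [v]. *)
Lemma channel_outer u v : S u -> S v ->
  L (u *m adj v) = coherence u v *: (u *m adj v).
Proof.
move=> Su Sv; set A := L _.
have orthC z x : pure_state z -> dot z (x - dot z x *: z) = 0.
  by move=> z1; rewrite dotBr dotZr z1 mulr1 subrr.
have left_ y : A *m y = dot u (A *m y) *: u.
  apply/eqP; rewrite -subr_eq0; apply/eqP/dot_eq0.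
  set x := _ - _; have ux : dot u x = 0 by apply/orthC/Spure.
  have [xy _] := cp_isotropic v y (fixed_isotropic Su ux).
  rewrite -[dot x x]/(dot x (A *m y - dot u (A *m y) *: u)) dotBr xy.
  by rewrite dotZr (dot_eq0C ux) mulr0 subrr.
apply: col_op_ext => y; rewrite -scalemxAl mulmx_outer scalerA.
have := orthC v y (Spure Sv); set x := _ - _ => vx.
have [_ xy] := cp_isotropic u u (fixed_isotropic Sv vx).
rewrite left_ (_ : y = x + dot v y *: v); last by rewrite subrK.
rewrite mulmxDr dotDr xy add0r -scalemxAr dotZr dotDr vx add0r dotZr.
by rewrite (Spure Sv) mulr1 mulrC.
Qed.

Lemma coherence_nonorth u v : S u -> S v -> nonorth u v -> coherence u v = 1.
Proof.
move=> Su Sv uv; have := Ltp (u *m adj v).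
rewrite channel_outer// mxtraceZ mxtrace_outer => e.
by move: uv; rewrite nonorth_sym => /mulIf; apply; rewrite mul1r.
Qed.

(** In the positive 3 x 3 matrix of coherences of u, v, z, the corner of u and v consists of ones.
    So the difference of the first two unit vectors is isotropic, and the rows of u and v
    coincide. *)
Lemma coherence_trans u v z : S u -> S v -> nonorth u v ->
  coherence u z = coherence v z.
Proof.
move=> Su Sv uv; pose w (a : 'I_3) := nth 0 [:: u; v; z] a.
have coh x : S x -> coherence x x = 1.
  move=> Sx; apply: coherence_nonorth => //.
  by rewrite /nonorth (Spure Sx) oner_neq0.
have vu : nonorth v u by rewrite nonorth_sym.
pose a : 'cV[C]_3 := delta_mx 0 0 - delta_mx 1 0.
have aM : adj a *m cp_form w w = row 0 (cp_form w w) - row 1 (cp_form w w).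
  have e (i : 'I_3) : adj (delta_mx i 0 : 'cV[C]_3) = delta_mx 0 i.
    exact: adjmx_delta.
  by rewrite adjmxB mulmxBl !e -!rowE.
have [|_ /matrixP/(_ 0 2)] := psd_radical (a := a) (psd_cp_form w w).
  rewrite aM mulmxBr -!colE !mxE /= -/(coherence u u) -/(coherence v v).
  rewrite -/(coherence u v) -/(coherence v u) !coh// !coherence_nonorth//.
  by rewrite !subrr.
by rewrite aM !mxE /= => /eqP; rewrite subr_eq0 => /eqP.
Qed.

Lemma coherence_connected u v : connected_set S -> S u -> S v -> coherence u v = 1.
Proof.
move=> Sc Su Sv; have [p [pS [up <-]]] := Sc u v Su Sv.
elim: p u Su pS up => [|x p IH] u Su pS /=.
  by move=> _; apply: coherence_nonorth; rewrite // /nonorth (Spure Su) oner_neq0.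
move=> /andP[ux xp]; have Sx : S x by apply: pS; rewrite mem_head.
rewrite (coherence_trans _ Su Sx ux); apply: IH => // y yp.
by apply: pS; rewrite in_cons yp orbT.
Qed.

Lemma channel_fixed_id X : connected_spanning_set S -> L X = X.
Proof.
move=> [Sc Ssp].
have L0 : L 0 = 0.
  by have := Llin (-1) 0 0; rewrite scaler0 addr0 scaleN1r addNr.
have LD Y Z : L (Y + Z) = L Y + L Z by rewrite -[Y]scale1r Llin !scale1r.
have LZ e Y : L (e *: Y) = e *: L Y by rewrite -[_ *: Y]addr0 Llin L0 addr0.
have Lsum I (r : seq I) (F : I -> op) :
    L (\sum_(i <- r) F i) = \sum_(i <- r) L (F i).
  exact: (big_morph L LD L0).
(* Expanding both vectors over [S] leaves outer products of members of [S], whose coherences are all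
   1; matrix units are then a special case. *)
have Louter u v : L (u *m adj v) = u *m adj v.
  have [s [sS us]] := Ssp u; have [t [tS vt]] := Ssp v.
  rewrite (@coord_span _ _ _ (in_tuple s) _ us).
  rewrite (@coord_span _ _ _ (in_tuple t) _ vt).
  rewrite mulmx_suml Lsum; apply: eq_bigr => i _.
  rewrite adjmx_sum mulmx_sumr Lsum; apply: eq_bigr => j _.
  rewrite adjmxZ -scalemxAl -!scalemxAr !LZ channel_outer ?coherence_connected//.
  - by rewrite scale1r.
  - by apply: sS; rewrite mem_nth.
  - by apply: tS; rewrite mem_nth.
  - by apply: sS; rewrite mem_nth.
  - by apply: tS; rewrite mem_nth.
rewrite [X]matrix_sum_delta Lsum; apply: eq_bigr => i _; rewrite Lsum.
apply: eq_bigr => j _; rewrite LZ.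
rewrite (_ : delta_mx i j =
  (delta_mx i 0 : vec) *m adj (delta_mx j 0 : vec)) ?Louter//.
rewrite (_ : adj _ = delta_mx 0 j) ?mul_delta_mx//.
exact: adjmx_delta.
Qed.

End Fixed.

End CompletelyPositive.

End Channel.

(** * Identification sets and connected bases *)

Section IdentificationSets.

Variables (n : nat) (dims : 'I_n -> nat) (R : realType).
Local Notation C := R[i].
Local Notation vec := 'cV[C]_(dimH dims).
Local Notation op := 'M[C]_(dimH dims).
Implicit Types (u v w x y : vec) (s : seq vec) (S T : vec -> Prop).

Lemma completely_positive_conj (A : op) (L : op -> op) :
  completely_positive L -> completely_positive (fun X => A *m L X *m adj A).
Proof.
move=> Lcp k X /Lcp Xp w; have := Xp (fun a => adj A *m w a).
rewrite (_ : \sum_(a < k) _ = \sum_(a < k) \sum_(b < k)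
  dot (w a) (A *m L (X a b) *m adj A *m w b))//.
by apply: eq_bigr => a _; apply: eq_bigr => b _; rewrite -!mulmxA [RHS]dot_mulr.
Qed.

Lemma quantum_channel_conj (V : op) (L : op -> op) : V \is unitarymx ->
  quantum_channel L -> quantum_channel (fun X => unitary_channel V (L X)).
Proof.
move=> HV [Llin Lcp Ltp]; split.
- move=> a X Y; rewrite /unitary_channel Llin mulmxDr mulmxDl.
  by rewrite -scalemxAr -scalemxAl.
- exact: completely_positive_conj.
- by move=> X; rewrite mxtrace_mulC mulmxA unitary_adjl// mul1mx.
Qed.

Lemma quantum_channel_unitary (V : op) :
  V \is unitarymx -> quantum_channel (unitary_channel V).
Proof. by move=> HV; apply: (quantum_channel_conj HV (L := id)); split. Qed.

Lemma unitary_adj (V : op) : V \is unitarymx -> adj V \is unitarymx.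
Proof. by rewrite /adj map_trmx trmxC_unitary. Qed.

Lemma unitary_channelK (V : op) (X : op) :
  V \is unitarymx -> unitary_channel (adj V) (unitary_channel V X) = X.
Proof.
move=> HV; rewrite /unitary_channel adjmxK !mulmxA unitary_adjl// mul1mx.
by rewrite -mulmxA unitary_adjl// mulmx1.
Qed.

(** Following [L] by conjugation with [adj U] reduces to a channel that fixes the states of [S]. *)
Lemma connected_spanning_identification (U : op) S : U \is unitarymx ->
  (forall v, S v -> pure_state v) -> connected_spanning_set S ->
  identification_set U S.
Proof.
move=> HU Sp Scs L Lch Lfix X.
have HV := unitary_adj HU.
have [Vlin Vcp Vtp] := quantum_channel_conj HV Lch.
have fixS v : S v -> unitary_channel (adj U) (L (proj v)) = proj v.
  by move=> Sv; rewrite Lfix// unitary_channelK.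
have := channel_fixed_id Vcp Vlin Vtp Sp fixS X Scs.
by move=> /(congr1 (unitary_channel U)); rewrite -{1}[U]adjmxK unitary_channelK.
Qed.

(** Since [U] and [U W] give the same channel, they agree on |v><u|. The reflection [W] flips [v]
    and fixes [u], so |v><u| equals its own opposite. *)
Lemma identification_reducible (U P : op) S u v : U \is unitarymx ->
  identification_set U S -> adj P = P -> P *m P = P ->
  (forall x, S x -> P *m x = x \/ P *m x = 0) ->
  P *m u = u -> P *m v = 0 -> u != 0 -> v = 0.
Proof.
move=> HU Sid Ph Pi SP Pu Pv u0.
pose W := P *+ 2 - 1%:M.
have Wh : adj W = W by rewrite adjmxB mulr2n adjmxD Ph adjmx1.
have WW : W *m W = 1%:M.
  rewrite /W mulr2n mulmxBl !mulmxBr !mulmxDl !mulmxDr Pi !mulmx1 !mul1mx.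
  by rewrite addrK opprB addrC subrK.
have HW : W \is unitarymx.
  by apply/unitarymxP; rewrite -map_trmx -/(adj W) Wh.
have HUW : U *m W \is unitarymx by apply: mul_unitarymx.
have fixW x : S x -> unitary_channel (U *m W) (proj x) = unitary_channel U (proj x).
  move=> /SP Px; rewrite -!proj_unitary -mulmxA.
  have [-> //|->] : W *m x = x \/ W *m x = - x.
    rewrite mulmxBl mulr2n mulmxDl mul1mx.
    by case: Px => ->; [left; rewrite addrK | right; rewrite !addr0 sub0r].
  rewrite mulmxN -scaleN1r /proj adjmxZ -scalemxAl -scalemxAr scalerA.
  by rewrite rmorphN1 mulrNN mulr1 scale1r.
have := Sid _ (quantum_channel_unitary HUW) fixW (v *m adj u).
move=> /(congr1 (unitary_channel (adj U))).
rewrite unitary_channelK// {2}/unitary_channel adjmxM Wh !mulmxA.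
rewrite -[unitary_channel _ _]/(adj U *m _ *m _) adjmxK !mulmxA.
rewrite unitary_adjl// mul1mx -!mulmxA unitary_adjl// mulmx1 mulmxA.
have -> : W *m v = - v by rewrite mulmxBl mulr2n mulmxDl Pv addr0 sub0r mul1mx.
have -> : adj u *m W = adj u.
  by rewrite -{1}Wh -adjmxM mulmxBl mulr2n mulmxDl Pu mul1mx addrK.
rewrite mulNmx => /eqP; rewrite eq_sym -subr_eq0 opprK -mulr2n -scaler_nat.
rewrite scaler_eq0 pnatr_eq0 /= => /eqP /(congr1 (fun X : op => X *m u)).
rewrite mulmx_outer mul0mx => /eqP; rewrite scaler_eq0 => /orP[|/eqP//].
by move=> /eqP/dot_eq0 ue; rewrite ue eqxx in u0.
Qed.

(** Greedy extension stops because a free list is no longer than the dimension; the induction is on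
    the room left. It serves both for finite spanning lists and for growing connected bases. *)
Lemma free_extension_max (Q : seq vec -> Prop) (T : seq vec -> Prop) s :
  (forall t, Q t -> free t) ->
  (forall t, Q t -> T t \/ exists x, Q (x :: t)) -> Q s -> exists t, Q t /\ T t.
Proof.
move=> Qfree Qext; have [m] := ubnP (\dim {: vec} - size s)%N.
elim: m s => // m IH s; rewrite ltnS => sm Qs.
have [Ts|[x Qx]] := Qext s Qs; first by exists s.
apply: (IH (x :: s)) => //; apply: leq_trans sm.
have := Qfree _ Qx; rewrite /free => /eqP e.
have : (\dim <<x :: s>> <= \dim {:vec})%N by apply/dimvS/subvf.
by rewrite e /= => h; rewrite ltn_sub2l.
Qed.

(** [S] may be infinite; this supplies the list that [exists_orth_proj] takes. *)
Lemma finite_span S :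
  exists s, (forall x, x \in s -> S x) /\ forall x, S x -> x \in <<s>>%VS.
Proof.
pose Q s := free s /\ forall x, x \in s -> S x.
have [|||s [[_ Ss] sS]] := @free_extension_max Q
  (fun s => forall x, S x -> x \in <<s>>%VS) [::].
- by move=> t [].
- move=> t [ft tS]; have [h|h] := pselect (forall x, S x -> x \in <<t>>%VS).
    by left.
  right; have [x /not_implyP[Sx /negP xt]] : exists x, ~ (S x -> x \in <<t>>%VS).
    by apply/existsNP.
  exists x; split; first by rewrite free_cons xt.
  by move=> y; rewrite in_cons => /orP[/eqP ->|/tS].
- by split; rewrite ?nil_free.
by exists s.
Qed.

(** The projector onto the span of [S] fixes every member, so [identification_reducible] leaves it
    no kernel. *)
Lemma identification_spanning (U : op) S : U \is unitarymx ->
  (1 < dimH dims)%N -> (forall v, S v -> pure_state v) ->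
  identification_set U S -> spanning_set S.
Proof.
move=> HU d1 Sp Sid y; have [s [sS Ss]] := finite_span S.
exists s; split=> //.
have [P [Ph Pi Ps [Pr _]]] := exists_orth_proj s.
pose z := y - P *m y.
suff z0 : z = 0 by rewrite -[y](subrK (P *m y)) -/z z0 add0r.
have Pz : P *m z = 0 by rewrite mulmxBr mulmxA Pi subrr.
have [[u Su]|noS] := pselect (exists u, S u).
  apply: (identification_reducible (u := u) HU Sid Ph Pi) => //.
  - by move=> x Sx; left; apply/Ps/Ss.
  - by apply/Ps/Ss.
  - by apply/pure_state_neq0/Sp.
(* For empty [S] every projector qualifies. The one onto a basis vector has a second basis vector in
   its kernel, which is where dimension at least 2 enters. *)
pose e0 : vec := delta_mx (Ordinal (ltnW d1)) 0.
pose e1 : vec := delta_mx (Ordinal d1) 0.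
have dotd i v : dot (delta_mx i 0) v = v i 0.
  rewrite /dot (_ : adj _ = delta_mx 0 i) -?rowE ?mxE//.
  exact: adjmx_delta.
have e00 : dot e0 e0 = 1 by rewrite dotd mxE !eqxx.
suff e10 : e1 = 0.
  have := dotd (Ordinal d1) e1; rewrite -/e1 e10 dot0l.
  move=> h; move/matrixP: e10 => /(_ (Ordinal d1) 0)/eqP.
  by rewrite !mxE !eqxx oner_eq0.
apply: (identification_reducible (P := proj e0) (u := e0) HU Sid).
- exact: adjmx_proj.
- by rewrite {2}/proj mulmxA mulmx_proj e00 scale1r.
- by move=> x Sx; case: noS; exists x.
- by rewrite mulmx_proj e00 scale1r.
- by rewrite mulmx_proj dotd mxE /= scale0r.
- exact: pure_state_neq0.
Qed.

(** Take the projector onto the span of the states reachable from [u]. Reachable members are fixed,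
    and the others are orthogonal to all reachable ones, hence killed; an unreachable [v] would then
    be zero. *)
Lemma identification_connected (U : op) S : U \is unitarymx ->
  (forall v, S v -> pure_state v) -> identification_set U S -> connected_set S.
Proof.
move=> HU Sp Sid u v Su Sv; apply: contrapT => unreach.
pose reach x := exists p : seq vec,
  (forall y, y \in p -> S y) /\ path (@nonorth _ _ _) u p /\ last u p = x.
have ext x y : reach x -> S y -> nonorth x y -> reach y.
  move=> [p [pS [pu pl]]] Sy xy; exists (rcons p y); split.
    by move=> z; rewrite mem_rcons in_cons => /orP[/eqP->|/pS].
  by rewrite rcons_path last_rcons pu pl.
have [s [sS Ss]] := finite_span (fun x => S x /\ reach x).
have [P [Ph Pi Ps [_ P0]]] := exists_orth_proj s.
have ru : reach u by exists [::].
have PN x : S x -> ~ reach x -> P *m x = 0.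
  move=> Sx nx; apply: P0 => y /sS[Sy ry]; apply/eqP/negPn/negP => yx.
  by apply: nx; apply: ext yx.
have Pu : P *m u = u by apply/Ps/Ss.
have : v = 0.
  apply: (identification_reducible HU Sid Ph Pi _ Pu) => //.
  - move=> x Sx; have [rx|nx] := pselect (reach x); last by right; apply: PN.
    by left; apply/Ps/Ss.
  - exact: PN.
  - exact/pure_state_neq0/Sp.
by apply/eqP/pure_state_neq0/Sp.
Qed.

Lemma connected_set_cons c x s : connected_set (fun y => y \in s) ->
  c \in s -> nonorth c x -> connected_set (fun y => y \in x :: s).
Proof.
move=> sc cs cx u v.
have lift a b : a \in s -> b \in s -> exists p : seq vec,
    (forall y, y \in p -> y \in x :: s) /\ path (@nonorth _ _ _) a p /\ last a p = b.
  move=> /sc h /h [p [ps pab]]; exists p; split=> // y /ps ys.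
  by rewrite in_cons ys orbT.
rewrite !in_cons => /predU1P[->|us] /predU1P[->|vs].
- by exists [::].
- have [p [ps [pc pl]]] := lift c v cs vs; exists (c :: p); split => /=.
    by move=> y; rewrite in_cons => /predU1P[->|/ps//]; rewrite in_cons cs orbT.
  by rewrite nonorth_sym cx.
- have [p [ps [pc pl]]] := lift u c us cs; exists (rcons p x); split.
    by move=> y; rewrite mem_rcons in_cons => /predU1P[->|/ps//]; rewrite mem_head.
  by rewrite rcons_path last_rcons pc pl.
- exact: lift.
Qed.

(** Take the first step of the path that leaves [V]. With [V] the span of a partial basis, this
    finds a new vector attached to it. *)
Lemma path_exit (V : {vspace vec}) u p :
  path (@nonorth _ dims R) u p -> u \in V -> last u p \notin V ->
  exists y x, [/\ y \in V, x \in p, x \notin V & nonorth y x].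
Proof.
elim: p u => [|x p IH] u /=; first by move=> _ ->.
move=> /andP[ux xp] uV lV; have [xV|xV] := boolP (x \in V).
  have [y [z [yV zp zV yz]]] := IH x xp xV lV.
  by exists y, z; split; rewrite // in_cons zp orbT.
by exists u, x; split; rewrite ?mem_head.
Qed.

(** Growth in the manner of a spanning tree. While some [z] of [S] is outside the span, a path from
    a member of the list to [z] exits the span at some [x]. As [x] is nonorthogonal to a vector of
    the span, it is nonorthogonal to a member of the list, so adding it keeps the list free and
    connected. *)
Lemma connected_free_spanning S : (forall v, S v -> v != 0) ->
  connected_spanning_set S -> exists s,
  [/\ forall x, x \in s -> S x, free s, connected_set (fun x => x \in s) &
      forall y, y \in <<s>>%VS].
Proof.
move=> S0 [Sc Ssp].
pose Q s := [/\ free s, forall x, x \in s -> S x & connected_set (fun x => x \in s)].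
have [|||s [[sf sS sc] sfull]] := @free_extension_max Q
  (fun s => forall y, y \in <<s>>%VS) [::].
- by move=> t [].
- move=> t [ft tS tc]; have [h|h] := pselect (forall y, y \in <<t>>%VS).
    by left.
  right; have [z Sz zt] : exists2 z, S z & z \notin <<t>>%VS.
    apply: contrapT => noz; apply: h => y; have [r [rS yr]] := Ssp y.
    move: yr; apply: subvP; apply/span_subvP => x /rS Sx.
    by apply/negPn/negP => xt; apply: noz; exists x.
  have cons_case x : S x -> x \notin <<t>>%VS ->
      connected_set (fun y => y \in x :: t) -> exists x, Q (x :: t).
    move=> Sx xt xc; exists x; split=> //; first by rewrite free_cons xt.
    by move=> y; rewrite in_cons => /predU1P[->|/tS].
  (* An empty list offers no start for a path, so [z] becomes its first member. *)
  case: t ft tS tc {h} zt cons_case => [|b t] ft tS tc zt cons_case.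
    apply: (cons_case z) => // u v; rewrite !mem_seq1 => /eqP-> /eqP->.
    by exists [::].
  have Sb : S b by apply: tS; rewrite mem_head.
  have [p [pS [pb pl]]] := Sc b z Sb Sz.
  have bt : b \in <<b :: t>>%VS by rewrite memv_span ?mem_head.
  have lt : last b p \notin <<b :: t>>%VS by rewrite pl.
  have [y [x [yt xp xt yx]]] := path_exit pb bt lt.
  have [c ct cx] : exists2 c, c \in b :: t & nonorth c x.
    apply: contrapT => noc; move/negP: yx; apply; apply/eqP.
    have -> := @coord_span _ _ _ (in_tuple (b :: t)) _ yt.
    rewrite dot_suml big1// => i _; rewrite dotZl.
    suff -> : dot (in_tuple (b :: t))`_i x = 0 by rewrite mulr0.
    apply/eqP/negPn/negP => ix; apply: noc; exists (in_tuple (b :: t))`_i => //.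
    by rewrite mem_nth.
  apply: (cons_case x) => //; first exact: pS.
  exact: connected_set_cons tc ct cx.
- by split; rewrite ?nil_free.
by exists s.
Qed.

Lemma free_basis_set s : free s -> (forall y, y \in <<s>>%VS) ->
  basis_set (fun x => x \in s).
Proof.
move=> sf sfull; split=> [y|t tu ts]; first by exists s.
rewrite (@perm_free _ _ _ [seq x <- s | x \in t]) ?filter_free//.
apply: uniq_perm => //; first by rewrite filter_uniq// free_uniq.
by move=> x; rewrite mem_filter; case xt : (x \in t); rewrite //= ts.
Qed.

Lemma basis_proper_not_spanning S T :
  basis_set T -> proper_subset_of S T -> ~ spanning_set S.
Proof.
move=> [_ Tf] [ST [v [Tv nSv]]] Ssp; have [s [sS vs]] := Ssp v.
(* [v] is not in [S], so prepending it to a list from [S] keeps the list duplicate-free inside [T];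
   yet [v] lies in the span of the rest. *)
have : free (v :: undup s).
  apply: Tf => [|x].
    by rewrite /= undup_uniq mem_undup andbT; apply/negP => /sS.
  by rewrite in_cons mem_undup => /predU1P[->//|/sS/ST].
rewrite free_cons => /andP[/negP + _]; apply.
by rewrite (eq_span (mem_undup s)).
Qed.

End IdentificationSets.

(** * Eigenvalues and the spectral gap *)

Lemma nth1_sort_lt1 (C : numClosedFieldType) (s : seq C) :
  all (fun x => x \is Num.real) s -> (1 < size s)%N ->
  (nth 0 (sort (fun x y => y <= x) s) 1 < 1) = (count (fun x => 1 <= x)%R s <= 1)%N.
Proof.
move=> sr s1; set t := sort _ s.
have st : perm_eq t s by rewrite perm_sort.
have tr : all (fun x => x \is Num.real) t by rewrite (perm_all _ st).
(* The order of [C] is partial; the reality of the entries makes them comparable. *)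
have t_sorted : sorted (fun x y : C => y <= x) t.
  by apply: (sort_sorted_in _ sr) => x y xr yr; rewrite orbC real_leVge.
rewrite -(perm_size st) in s1; rewrite -(seq.permP st).
case: t s1 t_sorted tr {st} => [|a [|b t]]//= _ /andP[ba bt] /and3P[ar br tr].
have [b1|b1] := real_ltP br (real1 _).
  suff -> : count (fun x => 1 <= x) t = 0%N by rewrite !addn0 leq_b1.
  apply/eqP; rewrite -leqn0 leqNgt -has_count; apply/hasPn => x xt.
  have : all (fun y => y <= b) t.
    by apply: order_path_min bt => x' y' z' /[swap]; apply: le_trans.
  by move=> /allP/(_ x xt) xb; rewrite lt_geF// (le_lt_trans xb).
by rewrite (le_trans b1 ba).
Qed.

Section SpectralGap.

Variables (n : nat) (dims : 'I_n -> nat) (R : realType).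
Local Notation C := R[i].
Local Notation vec := 'cV[C]_(dimH dims).
Local Notation op := 'M[C]_(dimH dims).
Implicit Types (x y : vec) (A : op).

Lemma adj_normal A : adj A = A -> A \is normalmx.
Proof. by move=> Ah; apply/normalmxP; rewrite -map_trmx -/(adj A) Ah. Qed.

Lemma spectral_decomp A : adj A = A ->
  A = adj (spectralmx A) *m diag_mx (spectral_diag A) *m spectralmx A.
Proof.
move=> /adj_normal/orthomx_spectralP; rewrite invmx_unitary ?spectral_unitarymx//.
by rewrite -map_trmx.
Qed.

Lemma spectral_diag_real A i : adj A = A -> spectral_diag A 0 i \is Num.real.
Proof.
move=> Ah; have Ahs : A \is hermsymmx.
  by apply/is_hermitianmxP; rewrite expr0 scale1r -map_trmx -/(adj A) Ah.
by have /mxOverP := hermitian_spectral_diag_real Ahs.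
Qed.

(** Counted with multiplicity, the second largest eigenvalue is below 1 iff at most one is at least
    1. Dimension at least 2 ensures that position 1 holds an eigenvalue and not the default 0 of
    [nth]. *)
Lemma spectral_gap_gt0P A : adj A = A -> (1 < dimH dims)%N ->
  0 < spectral_gap A <->
  forall i j, 1 <= spectral_diag A 0 i -> 1 <= spectral_diag A 0 j -> i = j.
Proof.
move=> Ah d1; rewrite /spectral_gap /second_largest_eigenvalue subr_gt0.
rewrite nth1_sort_lt1; first last.
- by rewrite size_map size_enum_ord.
- by apply/allP => _ /mapP[i _ ->]; apply: spectral_diag_real.
rewrite count_map -sum1_count big_enum_cond /=.
rewrite (eq_bigl (mem [pred i | 1 <= spectral_diag A 0 i])) // sum1_card.
split=> [/card_le1_eqP h i j i1 j1|h]; first exact: (h j i j1 i1).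
by apply/card_le1_eqP => i j i1 j1; apply: (h j i j1 i1).
Qed.

(** In eigenbasis coordinates a fixed vector is supported where the eigenvalue is 1. The gap leaves
    a single such coordinate, common to [x] and [y]. *)
Lemma spectral_gap_fixed A x y : adj A = A -> (1 < dimH dims)%N ->
  0 < spectral_gap A -> A *m x = x -> A *m y = y -> x != 0 -> exists c, y = c *: x.
Proof.
move=> Ah d1 /(spectral_gap_gt0P Ah d1) gap Ax Ay x0.
set S := spectralmx A; set D := spectral_diag A.
have SS : S *m adj S = 1%:M by apply/unitary_adjr/spectral_unitarymx.
have SS' : adj S *m S = 1%:M by apply/unitary_adjl/spectral_unitarymx.
have fixD z i : A *m z = z -> (S *m z) i 0 != 0 -> 1 <= D 0 i.
  rewrite {1}(spectral_decomp Ah) -/S -/D => e zi0.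
  have : diag_mx D *m (S *m z) = S *m z.
    by rewrite -[in RHS]e !mulmxA SS mul1mx.
  move=> /matrixP /(_ i 0); rewrite mul_diag_mx mxE => h.
  by rewrite (mulIf zi0 (etrans h (esym (mul1r _)))).
have [i xi0] : exists i, (S *m x) i 0 != 0.
  apply: contrapT => noi; move/negP: x0; apply.
  rewrite -[x]mul1mx -SS' -mulmxA; apply/eqP.
  suff -> : S *m x = 0 by rewrite mulmx0.
  apply/matrixP => i j; rewrite ord1 [RHS]mxE; apply/eqP/negPn/negP => h.
  by apply: noi; exists i.
pose c := (S *m y) i 0 / (S *m x) i 0.
suff e : S *m y = c *: (S *m x).
  by exists c; rewrite -[LHS]mul1mx -SS' -mulmxA e -scalemxAr mulmxA SS' mul1mx.
apply/matrixP => j k; rewrite ord1 [RHS]mxE.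
have [<-|ij] := eqVneq i j; first by rewrite divfK.
have z0 z : A *m z = z -> (S *m z) j 0 = 0.
  move=> Az; apply/eqP/negPn/negP => zj; move/negP: ij; apply; apply/eqP.
  by apply: gap; [apply: fixD xi0 | apply: fixD zj].
by rewrite !z0// mulr0.
Qed.

(** Two eigenvectors [f i] and [f j] with eigenvalues at least 1 would both be nonzero multiples of
    [v], yet they are orthogonal. *)
Lemma spectral_gap_proj v : (1 < dimH dims)%N -> pure_state v ->
  0 < spectral_gap (@proj _ dims R v).
Proof.
move=> d1 v1; set A := proj v.
have Ah : adj A = A by apply: adjmx_proj.
apply/(spectral_gap_gt0P Ah d1) => i j i1 j1; apply/eqP/negPn/negP => ij.
set S := spectralmx A in i1 j1; set D := spectral_diag A in i1 j1.
have SS : S *m adj S = 1%:M by apply/unitary_adjr/spectral_unitarymx.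
pose f k : vec := adj S *m delta_mx k 0.
have ff k l : dot (f k) (f l) = (k == l)%:R.
  rewrite dot_mulr adjmxK mulmxA SS mul1mx /dot.
  rewrite (_ : adj _ = delta_mx 0 k) -?rowE ?mxE ?eqxx ?andbT//.
  exact: adjmx_delta.
have Af k : dot v (f k) *: v = D 0 k *: f k.
  rewrite -mulmx_proj -/A {1}(spectral_decomp Ah) -/S -/D -!mulmxA [S *m _]mulmxA SS.
  rewrite mul1mx scalemxAr; congr (_ *m _); rewrite mul_diag_mx.
  by apply/matrixP => a b; rewrite !mxE; case: eqP => [->//|]; rewrite !mulr0.
have D0 k : 1 <= D 0 k -> dot v (f k) != 0.
  move=> k1; apply/eqP => e; have := Af k; rewrite e scale0r => /esym/eqP.
  rewrite scaler_eq0 gt_eqF ?(lt_le_trans ltr01)//= => /eqP fk0.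
  by have := ff k k; rewrite fk0 dot0l eqxx => /esym/eqP; rewrite oner_eq0.
have : dot (dot v (f i) *: v) (dot v (f j) *: v) = 0.
  by rewrite !Af dotZl dotZr ff (negPf ij) !mulr0.
rewrite dotZl dotZr v1 mulr1 => /eqP; rewrite mulf_eq0 conjC_eq0.
by rewrite (negPf (D0 i i1)) (negPf (D0 j j1)).
Qed.

End SpectralGap.

(** * Tensor products of operators *)

Lemma sum_prod_dffun (K : comNzRingType) (I : finType) (T : I -> finType)
    (F : forall i, T i -> K) :
  \sum_(f : {dffun forall i, T i}) \prod_i F i (f i) = \prod_i \sum_j F i j.
Proof.
(* Passing to [fprod] turns dependent functions into functions with tagged values, to which the
   ordinary distributive law applies; [untag] gives 0 on foreign tags. *)
rewrite (reindex (@dffun_of_fprod I T)); last exact/onW_bij/dffun_of_fprod_bij.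
pose P i := [ffun j => F i j].
transitivity (\sum_(t : fprod T) \prod_(i in I) P i (t i)).
  by apply: eq_bigr => t _; apply: eq_bigr => i _; rewrite !ffunE.
rewrite big_fprod.
transitivity (\prod_i \sum_(j in tagged_with T i) untag 0 (P i) j).
  by rewrite bigA_distr_big_dep; apply: eq_bigl.
apply: eq_bigr => i _; rewrite -(big_tag (fun i j => P i j) i).
by apply: eq_bigr => j _; rewrite ffunE.
Qed.

(** Summed over [c], the traces of [Q a *m Q c *m Q a] give the trace of [Q a], which the term c = a
    already supplies. The others are squared norms of [Q c *m Q a], so they vanish. *)
Lemma complete_projectors_orth (R : realType) p m (Q : 'I_m -> 'M[R[i]]_p) :
  (forall a, Q a *m Q a = Q a /\ adj (Q a) = Q a) -> \sum_a Q a = 1%:M ->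
  forall a b, a != b -> Q b *m Q a = 0.
Proof.
move=> Qp Qs a b ab.
have trE c : \tr (adj (Q c *m Q a) *m (Q c *m Q a)) = \tr (Q a *m Q c *m Q a).
  by have [ci ch] := Qp c; rewrite adjmxM ch (Qp a).2 mulmxA -(mulmxA (Q a)) ci.
have : \sum_c \tr (Q a *m Q c *m Q a) = \tr (Q a).
  by rewrite -raddf_sum -mulmx_suml -mulmx_sumr Qs mulmx1 (Qp a).1.
rewrite (bigD1 a)//= (Qp a).1 (Qp a).1 => /(canRL (addKr _)).
rewrite addNr => /eqP; rewrite psumr_eq0 => [/allP h|c _]; last first.
  by rewrite -trE mxtrace_adj_ge0.
apply: mxtrace_adj_eq0; rewrite trE.
by have /implyP/(_ _)/eqP := h b (mem_index_enum b); apply; rewrite eq_sym.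
Qed.

Section Tensor.

Variables (n : nat) (dims : 'I_n -> nat) (R : realType).
Local Notation C := R[i].
Local Notation vec := 'cV[C]_(dimH dims).
Local Notation op := 'M[C]_(dimH dims).
Implicit Types (A B : forall i : 'I_n, 'M[C]_(dims i)).

Lemma sum_midx (V : nmodType) (F : idx dims -> V) :
  \sum_(r < dimH dims) F (midx r) = \sum_o F o.
Proof.
rewrite [RHS](reindex (@midx n dims))//; apply/onW_bij.
exact: enum_val_bij.
Qed.

Lemma sum_prod_midx (F : forall i : 'I_n, 'I_(dims i) -> C) :
  \sum_(r < dimH dims) \prod_i F i (midx r i) = \prod_i \sum_j F i j.
Proof.
rewrite (sum_midx (fun o : idx dims => \prod_i F i (o i))).
exact: (sum_prod_dffun F).
Qed.

Lemma tensM A B : tens A *m tens B = tens (fun i => A i *m B i).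
Proof.
apply/matrixP => r c; rewrite !mxE.
under eq_bigr do rewrite !mxE -big_split /=.
rewrite (sum_prod_midx (fun i j => A i (midx r i) j * B i j (midx c i))).
by apply: eq_bigr => i _; rewrite mxE.
Qed.

Lemma adj_tens A : adj (tens A) = tens (fun i => adj (A i)).
Proof.
apply/matrixP => r c; rewrite !mxE rmorph_prod.
by apply: eq_bigr => i _; rewrite !mxE.
Qed.

Lemma tens0 A i : A i = 0 -> tens A = 0.
Proof.
by move=> Ai; apply/matrixP => r c; rewrite !mxE (bigD1 i)//= Ai mxE mul0r.
Qed.

Lemma tens1 : tens (fun i => 1%:M : 'M[C]_(dims i)) = 1%:M.
Proof.
apply/matrixP => r c; rewrite !mxE; have [->|rc] := eqVneq r c.
  by rewrite big1// => i _; rewrite mxE eqxx.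
have [i ri] : exists i, midx r i != midx c i.
  apply: contrapT => noi; move/negP: rc; apply; apply/eqP/enum_val_inj.
  apply/ffunP => i; apply/eqP/negPn/negP => h; apply: noi; by exists i.
by rewrite (bigD1 i)//= mxE (negPf ri) mul0r.
Qed.

Lemma tens_sum (M : local_meas dims R) :
  \sum_(o : idx dims) tens (fun i => M i (o i)) = tens (fun i => \sum_a M i a).
Proof.
apply/matrixP => r c; rewrite summxE !mxE.
under eq_bigr do rewrite mxE.
rewrite (sum_prod_dffun (fun i a => M i a (midx r i) (midx c i))).
by apply: eq_bigr => i _; rewrite summxE.
Qed.

(** * Joint outcomes of a local projective measurement *)

Section LocalMeasurement.

Variable M : local_meas dims R.
Arguments M : clear implicits.
Hypothesis Mp : is_local_projective M.
Local Notation outcome o := (tens (fun i => M i (o i))).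

Lemma outcome_idem (o : idx dims) : outcome o *m outcome o = outcome o.
Proof.
rewrite tensM; apply/matrixP => r c; rewrite !mxE.
by apply: eq_bigr => i _; rewrite ((Mp i).1 _).1.
Qed.

Lemma outcome_adj (o : idx dims) : adj (outcome o) = outcome o.
Proof.
rewrite adj_tens; apply/matrixP => r c; rewrite !mxE.
by apply: eq_bigr => i _; rewrite ((Mp i).1 _).2.
Qed.

Lemma outcome_orth (o o' : idx dims) : o != o' -> outcome o *m outcome o' = 0.
Proof.
move=> oo; have [i oi] : exists i, o' i != o i.
  apply: contrapT => noi; move/negP: oo; apply; apply/eqP/ffunP => i.
  by apply/eqP/negPn/negP => h; apply: noi; exists i; rewrite eq_sym.
rewrite tensM; apply: (@tens0 _ i).
exact: (complete_projectors_orth (Mp i).1 (Mp i).2).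
Qed.

Lemma outcome_sum : \sum_(o : idx dims) outcome o = 1%:M.
Proof.
rewrite tens_sum -tens1; apply/matrixP => r c; rewrite !mxE.
by apply: eq_bigr => i _; rewrite (Mp i).2.
Qed.

Lemma outcome_pass (o : idx dims) (acc : {set idx dims}) :
  outcome o *m pass_proj M acc = if o \in acc then outcome o else 0.
Proof.
rewrite /pass_proj mulmx_sumr; case: ifPn => oacc.
  rewrite (bigD1 o)//= outcome_idem big1 ?addr0// => o' /andP[_ oo].
  by rewrite outcome_orth// eq_sym.
rewrite big1// => o' oo; rewrite outcome_orth//.
by apply: contraNneq oacc => ->.
Qed.

Lemma pass_proj_adj (acc : {set idx dims}) : adj (pass_proj M acc) = pass_proj M acc.
Proof. by rewrite adjmx_sum; apply: eq_bigr => o _; apply: outcome_adj. Qed.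

Lemma pass_proj_idem (acc : {set idx dims}) :
  pass_proj M acc *m pass_proj M acc = pass_proj M acc.
Proof.
rewrite {1}/pass_proj mulmx_suml; apply: eq_bigr => o oacc.
by rewrite outcome_pass oacc.
Qed.

Lemma pass_outcome (o : idx dims) (acc : {set idx dims}) : o \in acc ->
  pass_proj M acc *m outcome o = outcome o.
Proof.
move=> oacc; rewrite -{1}outcome_adj -pass_proj_adj -adjmxM outcome_pass oacc.
exact: outcome_adj.
Qed.

End LocalMeasurement.

Lemma pass_proj_fix (M : local_meas dims R) acc v : is_local_projective M ->
  pure_state v -> \tr (pass_proj M acc *m proj v) = 1 -> pass_proj M acc *m v = v.
Proof.
move=> Mp v1 tr1; apply: hermitian_idem_fix => //.
- exact: pass_proj_adj.
- exact: pass_proj_idem.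
- by rewrite dot_mxtrace.
Qed.

End Tensor.

(** * Sums and sizes of lists under [List.In], the membership used for protocols *)

Lemma eq_big_In (V : nmodType) (T : Type) (r : seq T) (F G : T -> V) :
  (forall x, List.In x r -> F x = G x) -> \sum_(x <- r) F x = \sum_(x <- r) G x.
Proof.
elim: r => [|x r IH] FG; first by rewrite !big_nil.
rewrite !big_cons FG; last by left.
by congr (_ + _); apply: IH => y yr; apply: FG; right.
Qed.

Lemma In_map_seq (T : eqType) (T' : Type) (f : T -> T') (s : seq T) y :
  List.In y [seq f x | x <- s] -> exists2 x, x \in s & y = f x.
Proof.
elim: s => // x s IH /= [<-|/IH [z zs ->]]; first by exists x; rewrite ?mem_head.
by exists z; rewrite // in_cons zs orbT.
Qed.

Lemma mem_map_In (T : Type) (T' : eqType) (f : T -> T') (s : seq T) y :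
  y \in [seq f x | x <- s] <-> exists x, List.In x s /\ f x = y.
Proof.
elim: s => [|x s IH] /=; first by rewrite in_nil; split=> // -[? []].
rewrite in_cons; split=> [/predU1P[->|/IH [z [zs <-]]]|[z [[<-|zs] zy]]].
- by exists x; split; first left.
- by exists z; split; first right.
- by rewrite zy eqxx.
- by apply/orP; right; apply/IH; exists z.
Qed.

Lemma leq_size_sum (T : Type) (f : T -> nat) (s : seq T) :
  (forall x, List.In x s -> 0 < f x)%N -> (size s <= \sum_(x <- s) f x)%N.
Proof.
elim: s => [|x s IH] h //=; rewrite big_cons -add1n leq_add ?h//; first by left.
by apply: IH => y ys; apply: h; right.
Qed.

(** Pigeonhole; it yields exactly one setting per test state when there are only [d] settings. *)
Lemma sum_eq_size (T : Type) (f : T -> nat) (s : seq T) :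
  (forall x, List.In x s -> 0 < f x)%N -> (\sum_(x <- s) f x <= size s)%N ->
  forall x, List.In x s -> f x = 1%N.
Proof.
elim: s => [|x s IH] h //=; rewrite big_cons => le y.
have fx : (0 < f x)%N by apply: h; left.
have hs z : List.In z s -> (0 < f z)%N by move=> zs; apply: h; right.
have sz := leq_size_sum hs.
case=> [<-|ys].
  apply/eqP; rewrite eqn_leq fx andbT -(leq_add2r (size s)) add1n.
  by apply: leq_trans le; rewrite leq_add2l.
apply: IH => //; rewrite -ltnS; apply: leq_trans le.
by rewrite -add1n leq_add2r.
Qed.

(** * Verification protocols *)

Section Protocols.

Variables (n : nat) (dims : 'I_n -> nat) (R : realType).
Local Notation C := R[i].
Local Notation vec := 'cV[C]_(dimH dims).
Local Notation op := 'M[C]_(dimH dims).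
Implicit Types (u v w x y : vec) (b : seq vec) (S T : vec -> Prop).

Lemma verif_op_adj (phi : vec) (sp : state_protocol dims R) :
  state_protocol_valid phi sp -> adj (verif_op sp) = verif_op sp.
Proof.
move=> [spM [sppos _]]; rewrite adjmx_sum.
apply: eq_big_In => s /[dup] ssp /sppos sps.
rewrite adjmx_sum; apply: eq_big_In => t /sps t0.
by rewrite adjmxZ (pass_proj_adj (spM s ssp)) conj_Creal// gtr0_real.
Qed.

Lemma verif_op_fix (phi : vec) (sp : state_protocol dims R) x :
  state_protocol_valid phi sp ->
  (forall s, List.In s sp -> forall t, List.In t s.2 ->
     pass_proj s.1 t.2 *m x = x) ->
  verif_op sp *m x = x.
Proof.
move=> [_ [_ [sum1 _]]] fx; rewrite -[RHS]scale1r -sum1 /verif_op.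
rewrite mulmx_suml scaler_suml; apply: eq_big_In => s sp_s.
rewrite mulmx_suml scaler_suml; apply: eq_big_In => t st.
by rewrite -scalemxAl fx.
Qed.

(* If a single local measurement certifies phi with a gap, some joint outcome o
   accepted by all tests occurs on phi; the range of its product projector lies
   in the 1-eigenspace of the verification operator, which is spanned by phi.
   So phi is a multiple of a column of that projector. *)
Lemma single_setting_product (phi : vec) (s : setting dims R) :
  (0 < n)%N -> (1 < dimH dims)%N -> pure_state phi ->
  state_protocol_valid phi [:: s] -> 0 < spectral_gap (verif_op [:: s]) ->
  Prod phi.
Proof.
move=> n0 d1 phi1 val gap; have Oh := verif_op_adj val.
have [spM [_ [_ spass]]] := val.
have Mp : is_local_projective s.1 by apply: spM; left.
have pass t : List.In t s.2 -> pass_proj s.1 t.2 *m phi = phi.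
  by move=> ts; apply: pass_proj_fix => //; apply: spass ts; left.
set M := s.1 in Mp pass.
pose T (o : idx dims) := tens (fun i => @M i (o i)).
have [o To] : exists o, T o *m phi != 0.
  apply: contrapT => noo; move/negP: (pure_state_neq0 phi1); apply; apply/eqP.
  rewrite -[LHS]mul1mx -(outcome_sum Mp) mulmx_suml big1// => o _.
  by apply/eqP/negPn/negP => h; apply: noo; exists o.
have oacc t : List.In t s.2 -> o \in t.2.
  move=> ts; apply/negPn/negP => no; move/negP: To; apply; apply/eqP.
  by rewrite -(pass t ts) mulmxA /T outcome_pass// (negPf no) mul0mx.
have fixT x : verif_op [:: s] *m (T o *m x) = T o *m x.
  apply: verif_op_fix val _ => _ [<-|//] t ts.
  by rewrite mulmxA pass_outcome// oacc.
have fixphi : verif_op [:: s] *m phi = phi.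
  by apply: verif_op_fix val _ => _ [<-|//] t ts; apply: pass.
have [c Tc] : exists c, T o *m (delta_mx c 0 : vec) != 0.
  apply: contrapT => noc; move/negP: To; apply; apply/eqP.
  rewrite (_ : T o = 0) ?mul0mx//; apply/matrixP => r c; rewrite [RHS]mxE.
  apply/eqP/negPn/negP => h; apply: noc; exists c; apply: contra h => /eqP.
  by rewrite -colE => /matrixP/(_ r 0); rewrite !mxE => ->.
have [a phiE] := spectral_gap_fixed Oh d1 gap (fixT _) fixphi Tc.
split=> //.
(* The scalar [a] is absorbed into the factor of one party. *)
pose i0 := Ordinal n0.
exists (fun i => (if i == i0 then a else 1) *: \col_j @M i (o i) j (midx c i)) => r.
rewrite phiE -colE !mxE (bigD1 i0)//= [in RHS](bigD1 i0)//= !mxE ?eqxx mulrA.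
congr (_ * _); apply: eq_bigr => i /negPf ii0.
by rewrite !mxE ii0 mul1r.
Qed.

(** Party i asks whether its system is in the direction of [f i], and the test passes when all
    parties answer yes. The factors may be unnormalised, but their squared norms [N i] multiply to
    1, so normalising them leaves the tensor product of the projectors unchanged. *)
Lemma product_setting (phi : vec) : (forall i, 2 <= dims i)%N -> Prod phi ->
  exists (M : local_meas dims R) (acc : {set idx dims}),
    is_local_projective M /\ pass_proj M acc = proj phi.
Proof.
move=> Hd [phi1 [f phiE]].
pose N i : C := (adj (f i) *m f i) 0 0.
have NE i : N i = \sum_j (f i j 0)^* * f i j 0.
  by rewrite /N mxE; apply: eq_bigr => j _; rewrite adjmxE.
have prodN : \prod_i N i = 1.
  under eq_bigr do rewrite NE.
  rewrite -(sum_prod_midx (fun i j => (f i j 0)^* * f i j 0)).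
  apply: etrans phi1; rewrite /dot mxE.
  by apply: eq_bigr => r _; rewrite adjmxE !phiE rmorph_prod -big_split.
have N0 i : N i != 0.
  apply/eqP => Ni; move/eqP: prodN.
  by rewrite (bigD1 i)//= Ni mul0r eq_sym oner_eq0.
have Nr i : (N i)^* = N i.
  by rewrite -[LHS]adjmxE adjmxM adjmxK.
pose Q i := (N i)^-1 *: (f i *m adj (f i)).
have Qh i : adj (Q i) = Q i.
  by rewrite adjmxZ adjmxM adjmxK fmorphV /= Nr.
have Qi i : Q i *m Q i = Q i.
  rewrite /Q -scalemxAr -scalemxAl mulmxA -(mulmxA (f i)) [adj _ *m f i]mx11_scalar.
  by rewrite mul_mx_scalar -scalemxAl -/(N i) (scalerA _ (N i)) mulVf// scale1r.
(* Label 0 means yes and label 1 no, both available as [dims i] is at least 2; further labels get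
   the zero projector. *)
pose M : local_meas dims R := fun i a =>
  if a == 0%N :> nat then Q i else if a == 1%N :> nat then 1%:M - Q i else 0.
pose o0 : idx dims := [ffun i => Ordinal (ltnW (Hd i))].
exists M, [set o0]; split=> [i|].
  split=> [a|].
    rewrite /M; case: ifP => _; first by rewrite Qi Qh.
    case: ifP => _; last by rewrite mulmx0 adjmx0.
    by rewrite mulmxBl !mulmxBr Qi !mulmx1 !mul1mx subrr subr0 adjmxB adjmx1 Qh.
  rewrite (bigD1 (Ordinal (ltnW (Hd i))))//= (bigD1 (Ordinal (Hd i)))//=.
  rewrite big1 ?addr0 /M /=; first by rewrite addrC subrK.
  by move=> a; rewrite -!val_eqE /= => /andP[/negPf -> /negPf ->].
rewrite /pass_proj big_set1; apply/matrixP => r c; rewrite !mxE big_ord1 adjmxE !phiE.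
rewrite rmorph_prod -big_split /=.
transitivity (\prod_i ((N i)^-1 * (f i (midx r i) 0 * (f i (midx c i) 0)^*))).
  by apply: eq_bigr => i _; rewrite /M ffunE /= !mxE big_ord1 adjmxE.
by rewrite big_split /= prodfV prodN invr1 mul1r.
Qed.

(** With [Q] the complement of [proj v], the matrix [Q M Q] has nonnegative diagonal and trace 0. So
    the columns of [Q] are isotropic for [M], hence in its kernel, and [M] is concentrated on [v]
    with weight 1. *)
Lemma channel_output_pure (L : op -> op) u v : quantum_channel L ->
  pure_state u -> pure_state v -> \tr (proj v *m L (proj u)) = 1 ->
  L (proj u) = proj v.
Proof.
move=> [_ Lcp Ltp] u1 v1 tr1; set M := L (proj u) in tr1 *.
have Mp : psd M.
  by move=> x; rewrite -mulmxA; apply: channel_proj_ge0.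
have trM : \tr M = 1 by rewrite Ltp mxtrace_outer u1.
pose Q : op := 1%:M - proj v.
have vv : proj v *m proj v = proj v by rewrite {2}/proj mulmxA mulmx_proj v1 scale1r.
have Qh : adj Q = Q by rewrite adjmxB adjmx1 adjmx_proj.
have Qi : Q *m Q = Q by rewrite mulmxBl !mulmxBr vv !mulmx1 !mul1mx subrr subr0.
have trQ : \tr (Q *m M *m Q) = 0.
  by rewrite mxtrace_mulC mulmxA Qi mulmxBl mul1mx raddfB /= trM tr1 subrr.
have diagQ k : (Q *m M *m Q) k k = (adj (col k Q) *m M *m col k Q) 0 0.
  rewrite colE adjmxM Qh (_ : adj _ = delta_mx 0 k); last first.
    exact: adjmx_delta.
  by rewrite -rowE !mulmxA -colE -!row_mul !mxE.
have colQ k : M *m col k Q = 0 /\ adj (col k Q) *m M = 0.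
  apply: (psd_radical Mp); rewrite -diagQ.
  move/eqP: trQ; rewrite psumr_eq0 => [/allP/(_ k (mem_index_enum k))/eqP//|i _].
  by rewrite diagQ; apply: Mp.
have MQ : M *m Q = 0.
  apply/matrixP => i j; have [+ _] := colQ j; rewrite colE mulmxA -colE.
  by move=> /matrixP/(_ i 0); rewrite mxE => ->; rewrite !mxE.
have QM : Q *m M = 0.
  apply/matrixP => i j; have [_] := colQ i.
  rewrite colE adjmxM Qh (_ : adj _ = delta_mx 0 i); last first.
    exact: adjmx_delta.
  rewrite -mulmxA -rowE => /matrixP/(_ 0 j).
  by rewrite mxE => ->; rewrite !mxE.
have vM : M = proj v *m M.
  by apply/eqP; rewrite -subr_eq0 -{1}[M]mul1mx -mulmxBl QM.
have Mv : M = M *m proj v.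
  by apply/eqP; rewrite -subr_eq0 -{1}[M]mulmx1 -mulmxBr MQ.
rewrite vM Mv mulmxA /proj mulmxA -[v *m adj v *m M *m v]mulmxA.
rewrite mulmx_outer -scalemxAl -/(proj v) dot_mxtrace mxtrace_mulC tr1.
exact: scale1r.
Qed.

(** A nonzero vector cannot be orthogonal to a spanning set, so every member of [T] has a neighbour
    in [S], and paths in [S] join these neighbours. *)
Lemma connected_spanning_sup S T : (forall v, T v -> v != 0) ->
  subset_of S T -> connected_spanning_set S -> connected_spanning_set T.
Proof.
move=> T0 ST [Sc Ssp]; split=> [u v Tu Tv|y]; last first.
  by have [s [sS ys]] := Ssp y; exists s; split=> // x /sS/ST.
have neighbour x : T x -> exists2 a, S a & nonorth a x.
  move=> Tx; apply: contrapT => noa; move/negP: (T0 x Tx); apply; apply/eqP/dot_eq0.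
  have [s [sS xs]] := Ssp x.
  have {1}-> := @coord_span _ _ _ (in_tuple s) _ xs.
  rewrite dot_suml big1// => i _; rewrite dotZl.
  suff -> : dot (in_tuple s)`_i x = 0 by rewrite mulr0.
  apply/eqP/negPn/negP => ix; apply: noa; exists (in_tuple s)`_i => //.
  by apply: sS; rewrite mem_nth.
have [a Sa au] := neighbour u Tu; have [b Sb bv] := neighbour v Tv.
have [p [pS [ap pb]]] := Sc a b Sa Sb.
exists (a :: rcons p v); split; last first.
  by rewrite /= rcons_path last_rcons nonorth_sym au ap pb.
move=> x; rewrite in_cons mem_rcons in_cons => /or3P[/eqP->|/eqP->|/pS/ST]//.
exact: ST.
Qed.

Section Verification.

Variable U : op.
Hypothesis HU : U \is unitarymx.

(** A channel that agrees with [U] on the inputs passes every test, because valid tests accept the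
    correct outputs with certainty. *)
Lemma reliable_identification (P : protocol dims R) : verifies_reliably U P ->
  identification_set U (fun v => exists t, List.In t P /\ t.1.1 = v).
Proof.
move=> [[Pv _] Prel] L Lch Lfix; apply: Prel => // t tP s st w ws.
have [_ _ [_ [_ [_ tpass]]]] := Pv t tP.
by rewrite Lfix; [rewrite -proj_unitary; apply: tpass | exists t].
Qed.

Lemma valid_size_gt0 (P : protocol dims R) : verifies_reliably U P ->
  forall t, List.In t P -> (0 < size t.2)%N.
Proof.
move=> [[Pv _] _] [u [|s sp]]//= /Pv[_ _ [_ [_ [/eqP]]]].
by rewrite big_nil eq_sym oner_eq0.
Qed.

Lemma reliable_inputs_pure (P : protocol dims R) : verifies_reliably U P ->
  forall v, (exists t, List.In t P /\ t.1.1 = v) -> pure_state v.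
Proof. by move=> [[Pv _] _] v [t [/Pv[[t1 _] _ _] <-]]. Qed.

Lemma reliable_connected_spanning (P : protocol dims R) : (1 < dimH dims)%N ->
  verifies_reliably U P ->
  connected_spanning_set (fun v => exists t, List.In t P /\ t.1.1 = v).
Proof.
move=> d1 Prel; have Pp := reliable_inputs_pure Prel.
have Pid := reliable_identification Prel.
split; first exact: identification_connected Pid.
exact: identification_spanning Pid.
Qed.

Lemma reliable_size (P : protocol dims R) : (1 < dimH dims)%N ->
  verifies_reliably U P -> (dimH dims <= size P)%N.
Proof.
move=> d1 Prel; have [_ Ssp] := reliable_connected_spanning d1 Prel.
pose ins := [seq t.1.1 | t <- P].
have full : ({:vec} <= <<ins>>)%VS.
  apply/subvP => y _; have [s [sS ys]] := Ssp y.
  by move: ys; apply/subvP/span_subvP => x /sS /mem_map_In xP; apply: memv_span.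
have := leq_trans (dimvS full) (dim_span ins).
by rewrite dimvf /dim /= muln1 size_map.
Qed.

(** Each basis state is sent with probability 1/d and its output tested by the one setting of
    [product_setting]. The verification operator is then the projector onto the output: it has a
    gap, and passing pins the channel down on the basis. *)
Lemma basis_protocol b : (1 < dimH dims)%N -> (forall i, 2 <= dims i)%N ->
  (forall x, x \in b -> ProdU U x) -> free b ->
  connected_set (fun x => x \in b) -> (forall y, y \in <<b>>%VS) ->
  exists P : protocol dims R,
    [/\ verifies_reliably U P, ordinary P, entanglement_free U P &
        num_settings P = dimH dims].
Proof.
move=> d1 Hd bU bf bc bfull.
have sb : size b = dimH dims.
  move/eqP: bf; rewrite (_ : <<b>>%VS = fullv) ?dimvf.
    by rewrite /dim /= muln1.
  by apply/eqP; rewrite eqEsubv subvf; apply/subvP.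
(* Conditional on [Prod x], so that choice gives a function on all vectors; its values off product
   states are arbitrary. *)
pose spec (x : vec) (y : local_meas dims R * {set idx dims}) :=
  Prod x -> is_local_projective y.1 /\ pass_proj y.1 y.2 = proj x.
have [f fP] : {f & forall x, spec x (f x)}.
  apply: choice.
  move=> x; have [/(product_setting Hd)[M [acc h]]|] := pselect (Prod x).
    by exists (M, acc).
  by move=> nx; exists (fun _ _ => 0, set0).
pose p : C := (dimH dims)%:R^-1.
have d0 : 0 < (dimH dims)%:R :> C by rewrite ltr0n ltnW.
pose test x : vec * C * state_protocol dims R :=
  (x, p, [:: ((f (U *m x)).1, [:: (1, (f (U *m x)).2)])]).
have vtest x : verif_op (test x).2 = pass_proj (f (U *m x)).1 (f (U *m x)).2.
  by rewrite /verif_op /= !big_seq1 scale1r.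
have tr1 (x : vec) : pure_state x -> \tr (proj x *m proj x) = 1.
  by move=> x1; rewrite -dot_mxtrace mulmx_proj dotZr x1 mulr1.
exists [seq test x | x <- b]; split.
- split; first split.
  + move=> t ts; have [x /bU[Px PUx] ->] := In_map_seq ts.
    split=> //; first by rewrite invr_gt0.
    have [fM fp] := fP _ PUx; split; first by move=> s [<-|].
    split; first by move=> s [<-|[]] u [<-|[]].
    split; first by rewrite !big_seq1.
    by move=> s [<-|[]] u [<-|[]] /=; rewrite fp tr1//; case: PUx.
  + rewrite big_map /= big_const_seq count_predT sb iter_addr_0 -mulr_natl.
    by rewrite divff ?gt_eqF.
  move=> L Lch Lpass.
  apply: (connected_spanning_identification HU (S := fun x => x \in b)) => //.
  + by move=> v /bU[[]].
  + by split=> // y; exists b.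
  move=> v vb; have [[v1 _] PUv] := bU v vb; have [fM fp] := fP _ PUv.
  rewrite -proj_unitary; apply: channel_output_pure => //; first by case: PUv.
  rewrite -fp; apply: (Lpass (test v) _ _ (or_introl erefl) _ (or_introl erefl)).
  elim: (b) vb => // x s IH; rewrite in_cons => /predU1P[->|/IH]; first by left.
  by right.
- move=> t ts; have [x /bU[_ PUx] ->] := In_map_seq ts; rewrite vtest (fP _ PUx).2.
  by apply: spectral_gap_proj => //; case: PUx.
- by move=> t ts; have [x /bU[Px PUx] ->] := In_map_seq ts.
- by rewrite /num_settings big_map /= sum1_size.
Qed.

End Verification.

End Protocols.

(** * The cycle of implications through the five statements *)

Lemma dimH_gt1 (n : nat) (dims : 'I_n -> nat) :
  (0 < n)%N -> (forall i, 2 <= dims i)%N -> (1 < dimH dims)%N.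
Proof.
move=> n0 Hd; rewrite /dimH; apply/card_gt1P.
exists [ffun i => Ordinal (ltnW (Hd i))], [ffun i => Ordinal (Hd i)]; split=> //.
by apply/eqP => /ffunP/(_ (Ordinal n0)); rewrite !ffunE.
Qed.

Lemma ProdU_pure (n : nat) (dims : 'I_n -> nat) (R : realType)
  (U : 'M[R[i]]_(dimH dims)) v : ProdU U v -> pure_state v.
Proof. by case=> -[]. Qed.

Theorem theorem2 (n : nat) (dims : 'I_n -> nat) (R : realType)
  (Hn : (2 <= n)%N) (Hdims : forall i, (2 <= dims i)%N)
  (U : 'M[R[i]]_(dimH dims)) (HU : U \is unitarymx) :
  [<-> mu_eq U (dimH dims);
       connected_spanning_set (ProdU U);
       exists S, subset_of S (ProdU U) /\ connected_basis S;
       exists S, EFMIS U S;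
       exists P, verifies_reliably U P /\ entanglement_free U P].
Proof.
have d1 : (1 < dimH dims)%N by apply: dimH_gt1 => //; apply: ltnW.
have nz (S : 'cV[R[i]]_(dimH dims) -> Prop) :
    (forall v, S v -> pure_state v) -> forall v, S v -> v != 0.
  by move=> Sp v /Sp; apply: pure_state_neq0.
have protocol S : subset_of S (ProdU U) -> connected_spanning_set S ->
    exists P, [/\ verifies_reliably U P, ordinary P, entanglement_free U P &
                  num_settings P = dimH dims].
  move=> SU Scs; have Sp v (Sv : S v) : pure_state v := ProdU_pure (SU v Sv).
  have [b [bS bf bc bfull]] := connected_free_spanning (nz _ Sp) Scs.
  by apply: (basis_protocol HU d1 Hdims _ bf bc bfull) => x /bS/SU.
tfae.
(* At least d test states share d settings, so each has exactly one and its output is a product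
   state. The inputs thus lie in Prod(U), which inherits connectedness and span from them. *)
- move=> [[P [Prel [Pord Pnum]]] _].
  have sz1 : forall t, List.In t P -> size t.2 = 1%N.
    apply: sum_eq_size; first exact: valid_size_gt0 Prel.
    by rewrite -/(num_settings P) Pnum (reliable_size HU d1 Prel).
  apply: connected_spanning_sup (reliable_connected_spanning HU d1 Prel).
    by apply: nz => v; apply: ProdU_pure.
  move=> _ [t [tP <-]]; have [[Pv _] _] := Prel; have [[t1 Pt] _ tv] := Pv t tP.
  split; first by split.
  have Ut1 : pure_state (U *m t.1.1).
    by rewrite /pure_state dot_mulr mulmxA unitary_adjl// mul1mx.
  have gap := Pord t tP; case: t.2 (sz1 t tP) tv gap => [|s []]// _ tv gap.
  exact: (single_setting_product (ltnW Hn) d1 Ut1 tv gap).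
- move=> Ucs; have [b [bS bf bc bfull]] :=
    connected_free_spanning (nz _ (@ProdU_pure _ _ _ U)) Ucs.
  exists (fun x => x \in b); split=> //; split=> //.
  exact: free_basis_set.
- move=> [S [SU [Sc Sb]]]; exists S; split=> //.
  have Sp v (Sv : S v) : pure_state v := ProdU_pure (SU v Sv).
  split=> //; split.
    by apply: connected_spanning_identification => //; split=> //; case: Sb.
  (* Minimality: an identification set spans, which a proper subset of a basis cannot do. *)
  move=> S' S'S S'id; apply: (basis_proper_not_spanning Sb S'S).
  by apply: (identification_spanning HU d1 _ S'id) => v /(S'S.1 v)/Sp.
- move=> [S [[Sp [Sid _]] SU]].
  have [|P [Prel _ Pef _]] := protocol S SU; last by exists P.
  split; first exact: identification_connected Sid.
  exact: identification_spanning Sid.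
(* The inputs of an entanglement-free protocol lie in Prod(U) and yield an ordinary protocol with d
   settings. Conversely, every reliable protocol has at least d test states with at least one
   setting each. *)
- move=> [P [Prel Pef]].
  have [|P' [P'rel P'ord _ P'num]] :=
    protocol _ _ (reliable_connected_spanning HU d1 Prel).
    by move=> _ [t [/Pef[] ? ? <-]].
  split=> [|Q Qrel _]; first by exists P'.
  apply: leq_trans (reliable_size HU d1 Qrel) _.
  exact: leq_size_sum (valid_size_gt0 Qrel).
Qed.
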